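(* Let $G$ be an $(n,d,\lambda)$-graph and $k$ a natural number. Then $$\alpha_k(G)\le n\,\frac{\tilde{W}_k+\sum_{j=1}^k\lambda^j}{\sum_{j=1}^k d^j+\sum_{j=1}^k\lambda^j}.$$
   Context: Graphs are undirected, simple and loopless. An $(n,d,\lambda)$-graph is a $d$-regular graph on $n$ vertices whose adjacency matrix $A$ has eigenvalues $d=\lambda_1\ge\lambda_2\ge\cdots\ge\lambda_n\ge -d$ (listed with multiplicity), where $\lambda=\max\{|\lambda_2|,|\lambda_n|\}$. The $k$-independence number $\alpha_k(G)$ is the maximum number of vertices of $G$ that are mutually at distance greater than $k$. $\tilde{W}_k=\max_i\sum_{j=1}^k (A^j)_{ii}$ is the maximum over all vertices $i$ of $G$ of the number of closed walks of length at most $k$ starting at $i$ (lengths $j=1,\dots,k$ being counted). *)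

(* Defs.v *)
From mathcomp Require Import all_boot all_order all_algebra.
Set Implicit Arguments.
Unset Strict Implicit.
Unset Printing Implicit Defensive.
Import Order.TTheory GRing.Theory Num.Theory.
Local Open Scope ring_scope.

(* A graph on a finite vertex type T is given by its adjacency relation e;
   symmetry and irreflexivity are part of [ndl_graph] below. *)

Definition has_walk (T : finType) (e : rel T) (m : nat) (x y : T) : bool :=
  [exists p : m.-tuple T, path e x p && (last x p == y)].

(* [None] is the infinite distance between distinct components; a shortest
   walk visits each vertex at most once, so lengths below #|T| suffice
   (see [gdist_SomeP] and [gdist_NoneP]). *)
Definition gdist (T : finType) (e : rel T) (x y : T) : option nat :=
  let m := find (fun m => has_walk e m x y) (iota 0 #|T|) in
  if (m < #|T|)%N then Some m else None.

Definition gdist_gt (T : finType) (e : rel T) (k : nat) (x y : T) : bool :=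
  if gdist e x y is Some m then (k < m)%N else true.

Definition k_independent (T : finType) (e : rel T) (k : nat) (S : {set T}) :
  bool :=
  [forall x in S, forall y in S, (x != y) ==> gdist_gt e k x y].

Definition alpha (T : finType) (e : rel T) (k : nat) : nat :=
  \max_(S : {set T} | k_independent e k S) #|S|.

Definition adjmx (R : pzSemiRingType) (T : finType) (e : rel T) :
  'M[R]_#|T| :=
  \matrix_(i, j) (e (enum_val i) (enum_val j))%:R.

(* The entries of the powers of [adjmx] are nonnegative, so the default value
   0 does not affect the maximum over a nonempty vertex set. *)
Definition Wtilde (R : realDomainType) (T : finType) (e : rel T) (k : nat) :
  R :=
  \big[Num.max/0]_(i < #|T|) \sum_(1 <= j < k.+1) (adjmx R e ^+ j) i i.

(* Eigenvalues with multiplicity, in nonincreasing order: the i-th largest one,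
   lambda_i, is s`_(i.-1). *)
Definition spectrum (R : realDomainType) (m : nat) (A : 'M[R]_m)
  (s : seq R) : Prop :=
  sorted >=%R s /\ char_poly A = \prod_(x <- s) ('X - x%:P).

(* The identity lambda_1 = d and the bound -d <= lambda_n are consequences of
   regularity and are not required separately. The second eigenvalue exists
   only if 1 < n, which holds as soon as 0 < d. *)
Record ndl_graph (R : realDomainType) (T : finType) (e : rel T) (n d : nat)
  (lambda : R) : Prop := NdlGraph {
  ndl_card : #|T| = n;
  ndl_sym : symmetric e;
  ndl_irr : irreflexive e;
  ndl_regular : forall x : T, #|[set y | e x y]| = d;
  ndl_lambda : exists2 s : seq R, spectrum (adjmx R e) s &
    lambda = Num.max `|s`_1| `|s`_n.-1|
}.

Lemma has_walkP (T : finType) (e : rel T) (m : nat) (x y : T) :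
  reflect (exists p, [/\ size p = m, path e x p & last x p = y])
          (has_walk e m x y).
Proof.
apply: (iffP existsP) => [[p /andP[ep /eqP lp]]|[p [sp ep lp]]].
  by exists p; rewrite size_tuple.
by exists (Tuple (introT eqP sp)); rewrite ep lp /=.
Qed.

Lemma connect_walk (T : finType) (e : rel T) (x y : T) :
  connect e x y -> exists2 m, (m < #|T|)%N & has_walk e m x y.
Proof.
case/connectP=> p ep ->; case/shortenP: ep => q eq uq _.
exists (size q); last by apply/has_walkP; exists q.
by have := max_card (mem (x :: q)); rewrite (card_uniqP uq).
Qed.

Lemma gdist_SomeP (T : finType) (e : rel T) (x y : T) (m : nat) :
  gdist e x y = Some m <->
  has_walk e m x y /\ forall l, has_walk e l x y -> (m <= l)%N.
Proof.
rewrite /gdist; set a := fun l => _; set f := find a _.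
have fmin l : a l -> (l < #|T|)%N -> (f <= l)%N.
  move=> al lT; rewrite leqNgt; apply/negP => /(before_find 0%N).
  by rewrite nth_iota // add0n al.
have fwalk : (f < #|T|)%N -> a f.
  move=> fT; have := fT; rewrite -{1}(size_iota 0 #|T|) -has_find.
  by move=> /(nth_find 0%N); rewrite nth_iota.
have walkf l : a l -> (f < #|T|)%N.
  move=> /has_walkP[p [_ ep lp]].
  have /connect_walk[l' l'T al'] : connect e x y by apply/connectP; exists p.
  exact: leq_ltn_trans (fmin _ al' l'T) l'T.
have fle l : a l -> (f <= l)%N.
  move=> al; case: (ltnP l #|T|) => [/(fmin _ al)//|Tl].
  exact: leq_trans (ltnW (walkf _ al)) Tl.
split=> [|[am mmin]].
  by case: ifP => // fT [<-]; split; [exact: fwalk | exact: fle].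
have fT := walkf _ am; rewrite fT; congr Some; apply/eqP.
by rewrite eqn_leq fle // mmin //; exact: fwalk.
Qed.

Lemma gdist_NoneP (T : finType) (e : rel T) (x y : T) :
  gdist e x y = None <-> ~~ connect e x y.
Proof.
split=> [gN|nc].
  apply/negP => /connect_walk[m _ wm].
  have [l [wl lmin]] : exists l, has_walk e l x y /\
      forall l', has_walk e l' x y -> (l <= l')%N.
    have ex : exists m, has_walk e m x y by exists m.
    by case: (ex_minnP ex) => l wl lmin; exists l.
  have /gdist_SomeP : has_walk e l x y /\
      forall l', has_walk e l' x y -> (l <= l')%N by [].
  by rewrite gN.
case gE: (gdist e x y) => [m|//].
have /gdist_SomeP[/has_walkP[p [_ ep lp]] _] := gE.
by case/negP: nc; apply/connectP; exists p.
Qed.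

(* Main.v *)
(* Let S be k-independent and put v := 1_S, w := v - (|S| / n) 1. A walk of
   length at most k never joins distinct vertices of S, so
   sum_j v A^j v^T <= |S| Wtilde, the sum being over 1 <= j <= k. On the other
   hand v A^j v^T = |S|^2 / n d^j + w A^j w^T, and since w is orthogonal to the
   all-ones eigenvector, |w A^j w^T| <= lambda^j w w^T
   = lambda^j (|S| - |S|^2 / n); summing over j and dividing by |S| gives the
   bound. The estimate on w A^j w^T uses a unitary diagonalization over R[i]. *)
Require Import Defs.
From mathcomp Require Import all_boot all_order all_algebra.
From mathcomp Require Import complex ring.
Set Implicit Arguments.
Unset Strict Implicit.
Unset Printing Implicit Defensive.
Import Order.TTheory GRing.Theory Num.Theory.
Local Open Scope ring_scope.

(** * Unitary diagonalization and bounds on quadratic forms *)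

Lemma char_poly_conj {R : comUnitRingType} {n : nat} (P M : 'M[R]_n) :
  P \in unitmx -> char_poly (invmx P *m M *m P) = char_poly M.
Proof.
move=> Pu; rewrite /char_poly.
have -> : char_poly_mx (invmx P *m M *m P) =
    map_mx polyC (invmx P) *m char_poly_mx M *m map_mx polyC P.
  rewrite /char_poly_mx mulmxBr mulmxBl !map_mxM; congr (_ - _).
  by rewrite mul_mx_scalar -scalemxAl -map_mxM mulVmx // map_mx1 scalemx1.
rewrite !det_mulmx mulrAC -det_mulmx -map_mxM mulVmx // map_mx1 det1.
by rewrite mul1r.
Qed.

Local Open Scope sesquilinear_scope.

(** Unitary similarity to a diagonal matrix gives a second splitting of the characteristic
    polynomial, and a product of monic linear factors determines its roots up to order. *)
Lemma spectral_diag_perm {C : numClosedFieldType} {n : nat} (A : 'M[C]_n)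
  (s : seq C) : A \is normalmx -> char_poly A = \prod_(x <- s) ('X - x%:P) ->
  perm_eq [seq spectral_diag A 0 i | i <- enum 'I_n] s.
Proof.
move=> /orthomx_spectralP A_eq; rewrite {1}A_eq char_poly_conj ?spectral_unit //.
rewrite char_poly_trig ?diag_mx_is_trig // => pE.
apply: prod_XsubC_eq; rewrite big_map big_enum /= -pE; apply: eq_bigr => i _.
by rewrite mxE eqxx.
Qed.

(** The rows of [spectralmx A] form an orthonormal eigenbasis; multiplying by the adjoint on the
    right takes coordinates in it, where [A] acts diagonally. *)
Lemma spectral_coord {C : numClosedFieldType} {n : nat} (A : 'M[C]_n)
  (v : 'rV_n) (j : nat) (i : 'I_n) : A \is normalmx ->
  (v *m A ^+ j *m (spectralmx A)^t*) 0 i =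
  (v *m (spectralmx A)^t*) 0 i * spectral_diag A 0 i ^+ j.
Proof.
move=> nA; have Pu := spectral_unitarymx A.
have AP : A *m (spectralmx A)^t* =
    (spectralmx A)^t* *m diag_mx (spectral_diag A).
  have /orthomx_spectralP {1}-> := nA.
  by rewrite mulmxtVK // invmx_unitary.
elim: j => [|j IHj]; first by rewrite !expr0 mulmx1 mulr1.
rewrite exprSr -mulmxE -!mulmxA AP !mulmxA mul_mx_diag mxE IHj.
by rewrite exprSr mulrA.
Qed.

Lemma spectral_dot {C : numClosedFieldType} {n : nat} (A : 'M[C]_n)
  (v w : 'rV_n) :
  v *m w^t* = (v *m (spectralmx A)^t*) *m (w *m (spectralmx A)^t*)^t*.
Proof.
rewrite trmx_mul map_mxM trmxCK mulmxA; congr (_ *m _).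
by rewrite mulmxKtV // spectral_unitarymx.
Qed.

Lemma dot_coordE {C : numClosedFieldType} {n : nat} (v w : 'rV[C]_n) :
  (v *m w^t*) 0 0 = \sum_i v 0 i * (w 0 i)^*.
Proof. by rewrite mxE; apply: eq_bigr => i _; rewrite mxE [w^T _ _]mxE. Qed.

(* [lambda] bounds all eigenvalues but the leading one. If [`|mu| <= lambda] it
   bounds that one too; otherwise [u] spans its eigenspace, to which [w] is
   orthogonal. *)
Lemma deflated_form_bound {C : numClosedFieldType} {n : nat} (A : 'M[C]_n)
  (u w : 'rV_n) (s : seq C) (x0 mu lambda : C) (j : nat) :
  A \is normalmx -> char_poly A = \prod_(x <- x0 :: s) ('X - x%:P) ->
  `|x0| <= `|mu| -> {in s, forall x, `|x| <= lambda} -> lambda \is Num.real ->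
  u != 0 -> u *m A = mu *: u -> w *m u^t* = 0 ->
  `|(w *m A ^+ j *m w^t*) 0 0| <= lambda ^+ j * (w *m w^t*) 0 0.
Proof.
move=> nA pA x0mu sl lreal u0 uA.
have pe := spectral_diag_perm nA pA.
have := spectral_coord w j _ nA.
have := spectral_coord u 1 _ nA; rewrite expr1 uA -scalemxAl.
rewrite (spectral_dot A w u) (spectral_dot A _ w) (spectral_dot A w w).
have : u *m (spectralmx A)^t* != 0.
  apply: contraNneq u0 => z0.
  rewrite -(mulmx1 u) -(mulVmx (spectral_unit A)) mulmxA.
  by rewrite (invmx_unitary (spectral_unitarymx A)) z0 mul0mx.
(* From here on [D] holds the eigenvalues, and [z], [y], [yj] the eigenbasis coordinates of [u],
   [w], [w *m A ^+ j]. *)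
move: (spectral_diag A) (u *m _) (w *m (spectralmx A)^t*) (w *m _ *m _) pe.
move=> D z y yj pe z0 uD yjE.
have Ds i : `|D 0 i| <= lambda \/ D 0 i = x0.
  have : D 0 i \in x0 :: s.
    by rewrite -(perm_mem pe) map_f // mem_enum.
  by rewrite inE => /orP[/eqP|/sl]; [right|left].
have zD i : z 0 i * D 0 i = mu * z 0 i by rewrite -[D 0 i]expr1 -uD mxE.
move=> /matrixP/(_ 0 0); rewrite dot_coordE [RHS]mxE => yz.
have yD i : y 0 i != 0 -> `|D 0 i| <= lambda.
  case: (Ds i) => [//|Di] yi; rewrite Di.
  have [//|lx] := real_leP (normr_real x0) lreal.
  have lmu := lt_le_trans lx x0mu.
  (* Counted with multiplicity, only the head of [x0 :: s] exceeds [lambda] in modulus, so [i] is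
     the only such index. *)
  have un k : lambda < `|D 0 k| -> k = i.
    move=> lk; have : (#|[pred l | (lambda < `|D 0 l|)%R]| <= 1)%N.
      have -> : #|[pred l | lambda < `|D 0 l|]|
          = count (fun x => lambda < `|x|) [seq D 0 i | i <- enum 'I_n].
        by rewrite cardE count_map enumT /enum_mem size_filter.
      rewrite (permP pe) /= lx add1n ltnS leqn0 eqn0Ngt -has_count -all_predC.
      apply/allP => x /sl xl /=.
      by apply/negP => /(le_lt_trans xl); rewrite ltxx.
    by move/card_le1_eqP; apply; rewrite inE // Di.
  (* A nonzero [z 0 k] forces [D 0 k = mu], which exceeds [lambda] in modulus, whence [k = i]. *)
  have zk k : k != i -> z 0 k = 0.
    move=> ki; apply/eqP; move: (zD k) => /eqP.
    rewrite mulrC -subr_eq0 -mulrBl mulf_eq0 => /orP[|//]; rewrite subr_eq0.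
    by move/eqP => Dk; case/eqP: ki; apply: un; rewrite Dk.
  have zi : z 0 i != 0.
    apply: contraNneq z0 => zi0.
    by apply/eqP/rowP => k; rewrite mxE; have [->//|] := eqVneq k i; exact: zk.
  (* Orthogonality of [w] and [u] is reduced to the vanishing of a single product, neither factor of
     which is zero. *)
  move: yz; rewrite (bigD1 i) //= big1 => [|k ki]; last first.
    by rewrite zk // conjC0 mulr0.
  by move/eqP; rewrite addr0 mulf_eq0 conjC_eq0 (negPf yi) (negPf zi).
rewrite !dot_coordE mulr_sumr.
apply: le_trans (ler_norm_sum _ _ _) _; apply: ler_sum => i _.
rewrite yjE mulrAC -normCK normrM ger0_norm ?exprn_ge0 // mulrC.
have [->|/yD Di] := eqVneq (y 0 i) 0; first by rewrite normr0 expr0n !mulr0.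
by rewrite ler_wpM2r ?exprn_ge0 // normrX lerXn2r // ?nnegrE ?(le_trans _ Di).
Qed.

(** A real symmetric matrix becomes normal over [R[i]], and the embedding respects norms, order and
    characteristic polynomials, so the complex bound descends. *)
Lemma real_deflated_form_bound {R : rcfType} {n : nat} (A : 'M[R]_n)
  (u w : 'rV_n) (s : seq R) (x0 mu lambda : R) (j : nat) :
  A^T = A -> char_poly A = \prod_(x <- x0 :: s) ('X - x%:P) ->
  `|x0| <= `|mu| -> {in s, forall x, `|x| <= lambda} ->
  u != 0 -> u *m A = mu *: u -> w *m u^T = 0 ->
  `|(w *m A ^+ j *m w^T) 0 0| <= lambda ^+ j * (w *m w^T) 0 0.
Proof.
move=> symA pA x0mu sl u0 uA wu.
pose toC : {rmorphism R -> R[i]} := real_complex R.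
have normC x : `|toC x| = toC `|x|.
  have [x0'|x0'] := ger0P x; first by rewrite ger0_norm // lecR.
  by rewrite ltr0_norm ?ltcR // rmorphN.
have conjM m p (M : 'M_(m, p)) : (map_mx toC M)^t* = map_mx toC M^T.
  apply/matrixP => a b; rewrite !mxE; apply/CrealP/complex_realP.
  by exists (M b a).
have mapX : map_mx toC (A ^+ j) = map_mx toC A ^+ j.
  elim: (j) => [|m IHm]; first by rewrite !expr0 map_mx1.
  by rewrite !exprS map_mxM IHm.
have nA : map_mx toC A \is normalmx.
  by apply/normalmxP; rewrite conjM symA.
have := @deflated_form_bound _ _ _ (map_mx toC u) (map_mx toC w) (map toC s)
  (toC x0) (toC mu) (toC lambda) j nA.
rewrite -mapX !conjM -!map_mxM ![map_mx _ _ 0 0]mxE -rmorphXn -rmorphM.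
rewrite !normC !lecR; apply => //.
- rewrite -map_char_poly pA rmorph_prod -map_cons big_map /=.
  by apply: eq_bigr => x _; rewrite map_polyXsubC.
- by move=> _ /mapP[x xs ->]; rewrite normC lecR sl.
- by apply/complex_realP; exists lambda.
- by rewrite map_mx_eq0.
- by rewrite uA map_mxZ.
- by rewrite wu map_mx0.
Qed.

(** * Location of eigenvalues *)

Lemma eigenvalue_norm_le {R : numFieldType} {n : nat} (A : 'M[R]_n) (a d : R) :
  (forall i, \sum_j `|A i j| <= d) -> eigenvalue A a -> `|a| <= d.
Proof.
move=> Ad /eigenvalueP[v vA v0].
have [i vi] : exists i, v 0 i != 0.
  apply/existsP; apply: contraNT v0; rewrite negb_exists => /forallP v0.
  by apply/eqP/rowP => i; rewrite mxE; apply/eqP; have := v0 i; rewrite negbK.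
have v_gt0 : 0 < \sum_i `|v 0 i|.
  rewrite (bigD1 i) //= ltr_wpDr ?normr_gt0 //.
  by apply: sumr_ge0 => l _; exact: normr_ge0.
(* In the l1 norm, [v *m A] is at most [d] times [v], by the bound on the absolute row sums. *)
rewrite -(ler_pM2r v_gt0) mulr_sumr.
have -> : \sum_j `|a| * `|v 0 j| = \sum_j `|\sum_i v 0 i * A i j|.
  apply: eq_bigr => l _; rewrite -normrM.
  by move/rowP/(_ l): vA; rewrite !mxE => ->.
apply: (@le_trans _ _ (\sum_j \sum_i `|v 0 i| * `|A i j|)).
  apply: ler_sum => l _; apply: le_trans (ler_norm_sum _ _ _) _.
  by apply: ler_sum => m _; rewrite normrM.
rewrite exchange_big mulr_sumr; apply: ler_sum => l _.
by rewrite -mulr_sumr mulrC ler_wpM2r.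
Qed.

(** Entries of the tail lie between its first and its last: a nonnegative one is bounded by the
    former, a negative one by the modulus of the latter. *)
Lemma sorted_norm_le {R : realDomainType} (x0 : R) (s : seq R) :
  sorted >=%R (x0 :: s) -> {in s, forall x,
    `|x| <= Num.max `|(x0 :: s)`_1| `|(x0 :: s)`_(size s)|}.
Proof.
move=> ss x /(nthP 0)[i si <-]; rewrite -[s`_i]/((x0 :: s)`_i.+1).
have tr : transitive (>=%R : rel R) by move=> y a b ay yb; exact: le_trans yb ay.
have nle := sorted_leq_nth tr (@lexx _ R) 0 ss.
have h1 : (x0 :: s)`_i.+1 <= (x0 :: s)`_1.
  by apply: nle; rewrite ?inE //= ltnS (leq_ltn_trans _ si).
have h2 : (x0 :: s)`_(size s) <= (x0 :: s)`_i.+1.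
  by apply: nle; rewrite ?inE //= ltnS.
rewrite le_max; have [x_ge0|x_lt0] := ger0P (x0 :: s)`_i.+1.
  by rewrite (le_trans h1) // ler_norm.
apply/orP; right; rewrite -[leRHS]normrN (le_trans _ (ler_norm _)) //.
by rewrite lerN2.
Qed.

(** * Powers of the adjacency matrix and walks *)

Lemma adjmx_tr {R : pzSemiRingType} {T : finType} (e : rel T) :
  symmetric e -> (adjmx R e)^T = adjmx R e.
Proof. by move=> esym; apply/matrixP => i j; rewrite !mxE esym. Qed.

Lemma adjmx_expr_tr {R : comPzSemiRingType} {T : finType} (e : rel T) (j : nat) :
  symmetric e -> (adjmx R e ^+ j)^T = adjmx R e ^+ j.
Proof.
move=> /adjmx_tr trA; elim: j => [|j IHj]; first by rewrite expr0 trmx1.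
by rewrite exprS trmx_mul IHj trA mulmxE -exprSr exprS.
Qed.

Lemma sum_enum_val {R : pzSemiRingType} {T : finType} (S : {set T}) :
  \sum_(i < #|T|) (enum_val i \in S)%:R = #|S|%:R :> R.
Proof.
rewrite -(big_enum_val (fun x => (x \in S)%:R)) /= -sum1_card natr_sum.
rewrite [RHS]big_mkcond; apply: eq_bigr => x _; by case: ifP.
Qed.

Lemma adjmx_rowsum {R : pzSemiRingType} {T : finType} (e : rel T) (i : 'I_#|T|) :
  \sum_j adjmx R e i j = #|[set y | e (enum_val i) y]|%:R.
Proof. by rewrite -sum_enum_val; apply: eq_bigr => j _; rewrite mxE inE. Qed.

(** A nonzero entry of a product has a nonzero summand, which supplies the first edge; induction
    supplies the rest of the walk. *)
Lemma adjmx_walk {R : pzSemiRingType} {T : finType} (e : rel T) (j : nat)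
  (a b : 'I_#|T|) : (adjmx R e ^+ j) a b != 0 ->
  has_walk e j (enum_val a) (enum_val b).
Proof.
elim: j a => [|j IHj] a.
  rewrite expr0 mxE; have [-> _|_] := eqVneq a b; last by rewrite eqxx.
  by apply/has_walkP; exists [::].
rewrite exprS mxE => nz.
have [c] : exists c, adjmx R e a c * (adjmx R e ^+ j) c b != 0.
  apply/existsP; apply: contraNT nz; rewrite negb_exists => /forallP z.
  by rewrite big1 // => c _; apply/eqP; have := z c; rewrite negbK.
rewrite mxE; case eac: (e _ _); last by rewrite mul0r eqxx.
rewrite mul1r => /IHj/has_walkP[p [sp ep lp]].
by apply/has_walkP; exists (enum_val c :: p); rewrite /= sp eac ep.
Qed.

Lemma gdist_gt_walk {T : finType} (e : rel T) (k j : nat) (x y : T) :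
  gdist_gt e k x y -> has_walk e j x y -> (k < j)%N.
Proof.
rewrite /gdist_gt; case gE: (gdist e x y) => [m|] km xy.
  by have /gdist_SomeP[_ /(_ _ xy)] := gE; exact: leq_trans.
have /gdist_NoneP/negP[] := gE; apply/connectP.
by have /has_walkP[p [_ ep lp]] := xy; exists p.
Qed.

Definition indicator_row (R : pzSemiRingType) (T : finType) (S : {set T}) :
  'rV[R]_#|T| := \row_i (enum_val i \in S)%:R.

(** A nonzero off-diagonal term would yield a walk of length at most [k] between distinct vertices
    of [S]. *)
Lemma k_independent_form {R : pzSemiRingType} {T : finType} (e : rel T)
  (k j : nat) (S : {set T}) : k_independent e k S -> (j <= k)%N ->
  (indicator_row R S *m adjmx R e ^+ j *m (indicator_row R S)^T) 0 0
    = \sum_i (enum_val i \in S)%:R * (adjmx R e ^+ j) i i.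
Proof.
move=> /forall_inP Sk jk; rewrite mxE; apply: eq_bigr => b _.
rewrite !mxE; case bS: (enum_val b \in S); last by rewrite mulr0 mul0r.
rewrite mulr1 (bigD1 b) //= mxE bS big1 ?addr0 // => a ab.
rewrite mxE; case aS: (enum_val a \in S); last by rewrite mul0r.
rewrite mul1r; apply/eqP; apply: contraT => /adjmx_walk ej.
have /forall_inP/(_ _ bS)/implyP := Sk _ aS.
rewrite (inj_eq enum_val_inj) => /(_ ab)/gdist_gt_walk/(_ ej).
by rewrite ltnNge jk.
Qed.

(** * Lower bound on the quadratic form of an indicator vector *)

Lemma mulmx_eigen_expr {R : comPzRingType} {n : nat} (A : 'M[R]_n) (u : 'rV_n)
  (mu : R) (j : nat) : u *m A = mu *: u -> u *m A ^+ j = mu ^+ j *: u.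
Proof.
move=> uA; elim: j => [|j IHj]; first by rewrite !expr0 mulmx1 scale1r.
by rewrite exprSr -mulmxE mulmxA IHj -scalemxAl uA scalerA exprSr.
Qed.

Lemma ndl_lambda_ge0 {R : realDomainType} {T : finType} {e : rel T} {n d : nat}
  {lambda : R} : ndl_graph e n d lambda -> 0 <= lambda.
Proof. by case=> _ _ _ _ [s _ ->]; rewrite le_max normr_ge0. Qed.

Lemma indicator_form_ge {R : rcfType} {T : finType} (e : rel T) (n d j : nat)
  (lambda : R) (S : {set T}) : ndl_graph e n d lambda -> (0 < n)%N ->
  #|S|%:R ^+ 2 / n%:R * d%:R ^+ j
      - lambda ^+ j * (#|S|%:R - #|S|%:R ^+ 2 / n%:R)
    <= (indicator_row R S *m adjmx R e ^+ j *m (indicator_row R S)^T) 0 0.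
Proof.
case=> Tn esym _ ereg [s [ss sA] lambdaE] n_gt0.
pose A := adjmx R e; pose v := indicator_row R S.
pose u : 'rV[R]_#|T| := const_mx 1.
pose w := v - (#|S|%:R / n%:R) *: u.
have n0 : n%:R != 0 :> R by rewrite pnatr_eq0 -lt0n.
have trA := adjmx_tr (R := R) esym.
(* By symmetry, column sums of [A] are row sums, that is, degrees. *)
have uA : u *m A = d%:R *: u.
  apply/rowP => b; rewrite !mxE mulr1 -(ereg (enum_val b)) -adjmx_rowsum.
  by apply: eq_bigr => a _; rewrite !mxE mul1r esym.
have vu : (v *m u^T) 0 0 = #|S|%:R.
  by rewrite mxE -sum_enum_val; apply: eq_bigr => a _; rewrite !mxE mulr1.
have uv : (u *m v^T) 0 0 = #|S|%:R.
  by rewrite -vu -[in LHS](trmxK u) -trmx_mul mxE.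
have vv : (v *m v^T) 0 0 = #|S|%:R.
  rewrite mxE -sum_enum_val; apply: eq_bigr => a _.
  by rewrite !mxE -natrM mulnb andbb.
have uu : (u *m u^T) 0 0 = n%:R.
  rewrite mxE (eq_bigr (fun=> 1)) => [|a _]; last by rewrite !mxE mulr1.
  by rewrite sumr_const card_ord Tn.
have uAj := mulmx_eigen_expr j uA.
have Aju : A ^+ j *m u^T = d%:R ^+ j *: u^T.
  by rewrite -(adjmx_expr_tr j esym) -trmx_mul uAj linearZ.
have wu : w *m u^T = 0.
  apply/matrixP => a b; rewrite !ord1 mulmxBl -scalemxAl mxE vu mxE mxE uu.
  by rewrite mxE divfK // subrr.
have ww : (w *m w^T) 0 0 = #|S|%:R - #|S|%:R ^+ 2 / n%:R.
  rewrite {2}/w linearB linearZ /= mulmxBr -scalemxAr wu scaler0 subr0.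
  rewrite mulmxBl -scalemxAl mxE vv mxE mxE uv.
  by rewrite mulrAC -expr2.
(* On the right the component along [u] vanishes against [w]; on the left it leaves only the term in
   [d ^+ j]. *)
have wAw : (w *m A ^+ j *m w^T) 0 0
    = (v *m A ^+ j *m v^T) 0 0 - #|S|%:R ^+ 2 / n%:R * d%:R ^+ j.
  rewrite {2}/w linearB linearZ /= mulmxBr -scalemxAr -(mulmxA w _ u^T) Aju -scalemxAr wu.
  rewrite !scaler0 subr0 !mulmxBl -!scalemxAl uAj -scalemxAl.
  rewrite scalerA mxE; congr (_ + _); rewrite 2!mxE uv.
  by ring.
(* The characteristic polynomial has degree [n > 0], so there is a leading eigenvalue to split
   off. *)
have s_cons : exists x0 s', s = x0 :: s'.
  case: s sA {ss lambdaE} => [|x0 s']; last by exists x0, s'.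
  move/(congr1 (fun p : {poly R} => size p)).
  by rewrite size_char_poly Tn big_nil size_poly1; case: (n) n_gt0.
have [x0 [s' sE]] := s_cons; rewrite {}sE in ss sA lambdaE.
(* This identifies the index [n.-1] in the formula for [lambda] with the last entry of the
   spectrum. *)
have size_s' : size s' = n.-1.
  have /(congr1 (fun p : {poly R} => size p)) := sA.
  by rewrite size_char_poly size_prod_XsubC Tn => -[->].
have x0_le : `|x0| <= `|d%:R|.
  rewrite [leRHS]ger0_norm ?ler0n //; apply: (eigenvalue_norm_le (A := A)).
    move=> a; rewrite -(ereg (enum_val a)) -adjmx_rowsum ler_sum // => b _.
    by rewrite mxE ger0_norm ?ler0n.
  by rewrite eigenvalue_root_char sA root_prod_XsubC mem_head.
have s'_le : {in s', forall x, `|x| <= lambda}.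
  by move=> x xs; rewrite lambdaE -size_s'; exact: sorted_norm_le.
have u0 : u != 0.
  by apply: contraNneq n0 => u0; rewrite -uu u0 mul0mx mxE.
have := real_deflated_form_bound j trA sA x0_le s'_le u0 uA wu.
rewrite wAw ww ler_norml => /andP[+ _].
by rewrite lerBrDl.
Qed.

(** * Comparison with closed walks and the final bound *)

Lemma Wtilde_ge {R : realDomainType} {T : finType} (e : rel T) (k : nat)
  (i : 'I_#|T|) :
  \sum_(1 <= j < k.+1) (adjmx R e ^+ j) i i <= Wtilde R e k.
Proof.
exact: (le_bigmax _ (fun i => \sum_(1 <= j < k.+1) (adjmx R e ^+ j) i i)).
Qed.

Lemma Wtilde_ge0 {R : realDomainType} {T : finType} (e : rel T) (k : nat) :
  0 <= Wtilde R e k.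
Proof. exact: bigmax_ge_id. Qed.

Lemma k_independent_le {R : rcfType} {T : finType} (e : rel T) (n d k : nat)
  (lambda : R) (S : {set T}) : ndl_graph e n d lambda ->
  k_independent e k S ->
  #|S|%:R * (\sum_(1 <= j < k.+1) d%:R ^+ j + \sum_(1 <= j < k.+1) lambda ^+ j)
    <= n%:R * (Wtilde R e k + \sum_(1 <= j < k.+1) lambda ^+ j).
Proof.
move=> G Sk; have Tn := ndl_card G.
set Sd := \sum_(_ <= j < _) _; set Sl := \sum_(_ <= j < _) _.
have Sl_ge0 : 0 <= Sl.
  by apply: sumr_ge0 => j _; rewrite exprn_ge0 ?(ndl_lambda_ge0 G).
(* The empty set is treated apart because [#|S|] is cancelled below; a nonempty [S] also forces
   [n > 0]. *)
have [S0|S_gt0] := posnP #|S|.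
  by rewrite S0 mul0r mulr_ge0 ?addr_ge0 ?Wtilde_ge0 ?ler0n.
have n_gt0 : (0 < n)%N by rewrite -Tn (leq_trans S_gt0) ?max_card.
have SR : 0 < #|S|%:R :> R by rewrite ltr0n.
have nR : 0 < n%:R :> R by rewrite ltr0n.
(* The lower bounds are summed over [j]; exchanging the sums leaves, for each vertex of [S], a
   diagonal sum of at most [Wtilde R e k]. *)
have key : #|S|%:R ^+ 2 / n%:R * Sd - Sl * (#|S|%:R - #|S|%:R ^+ 2 / n%:R)
    <= #|S|%:R * Wtilde R e k.
  apply: (@le_trans _ _ (\sum_(1 <= j < k.+1)
      \sum_i (enum_val i \in S)%:R * (adjmx R e ^+ j) i i)).
    rewrite mulr_sumr mulr_suml -sumrB; apply: ler_sum_nat => j /andP[_ jk].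
    by rewrite -(k_independent_form Sk) // indicator_form_ge.
  rewrite exchange_big /= -sum_enum_val mulr_suml; apply: ler_sum => i _.
  by rewrite -mulr_sumr ler_wpM2l ?ler0n // Wtilde_ge.
have h : #|S|%:R / n%:R * Sd - Sl * (1 - #|S|%:R / n%:R) <= Wtilde R e k.
  rewrite -(ler_pM2l SR); apply: le_trans key; rewrite le_eqVlt; apply/orP; left.
  by apply/eqP; field; rewrite lt0r_neq0.
rewrite -(ler_pM2l nR) in h; rewrite [leRHS]mulrDr -lerBlDr; apply: le_trans h.
rewrite le_eqVlt; apply/orP; left.
by apply/eqP; field; rewrite lt0r_neq0.
Qed.

Theorem theorem4p2 (R : rcfType) (T : finType) (e : rel T) (n d k : nat)
  (lambda : R) (hG : ndl_graph e n d lambda) (hd : (0 < d)%N)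
  (hk : (0 < k)%N) :
  (alpha e k)%:R <=
    n%:R * ((Wtilde R e k + \sum_(1 <= j < k.+1) lambda ^+ j) /
            (\sum_(1 <= j < k.+1) d%:R ^+ j
              + \sum_(1 <= j < k.+1) lambda ^+ j)).
Proof.
(* The maximum is attained, since the empty set is admissible. *)
have [S Sk ->] : {S : {set T} | k_independent e k S & alpha e k = #|S|}.
  apply: eq_bigmax_cond; apply/card_gt0P; exists set0.
  by apply/forall_inP => x; rewrite inE.
(* [hk] provides the term [j = 1], which [hd] makes positive; hence the denominator is positive. *)
have d_gt0 : 0 < \sum_(1 <= j < k.+1) (d%:R : R) ^+ j.
  rewrite big_ltn // expr1 ltr_wpDr ?ltr0n //.
  by apply: sumr_ge0 => j _; rewrite exprn_ge0 ?ler0n.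
rewrite mulrA ler_pdivlMr; first exact: k_independent_le.
rewrite ltr_wpDr //; apply: sumr_ge0 => j _.
by rewrite exprn_ge0 ?(ndl_lambda_ge0 hG).
Qed.
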